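(* Let $K$ be a field and $f \in K[T]$ a monic irreducible polynomial of inseparability degree $q \in \mathbb{N}_{>0}$. Then the homomorphism of commutative monoids $\zeta_f \colon \mathrm{Part} \to \mathrm{Part}$ is given on the generators $[a]$, $a \geq 1$, by $$[a] \;\longmapsto\; l \cdot [k+1] + (q-l) \cdot [k] \;=\; \bigl[\underbrace{k+1, \dotsc, k+1}_{l}, \underbrace{k, \dotsc, k}_{q-l}\bigr],$$ where $k, l \in \mathbb{N}$ are the unique natural numbers with $a = kq + l$ and $l < q$.
   Context: Natural numbers $\mathbb{N}$ include $0$. The inseparability degree $q$ of $f$ is the multiplicity of each root of $f$ in an algebraic closure of $K$ ($q=1$ if and only if $f$ is separable). Partitions: $\mathrm{Part}$ is the set of (weakly) decreasing maps $\varphi \colon \mathbb{N}_{>0} \to \mathbb{N}$ that are eventually $0$, and $\mathrm{Part}_m$ is the subset of those with $\sum_i \varphi_i = m$. One writes $\varphi = [\varphi_1, \dotsc, \varphi_r]$ if $\varphi_i = 0$ for $i > r$ (so entries equal to $0$ may be dropped, and $[0]$ is the empty partition). $\mathrm{Part}$ is a commutative monoid under splicing $+$ (union of multisets of parts, e.g. $[3,1,1]+[4,2]=[4,3,2,1,1]$), with neutral element the empty partition; it is freely generated by the singletons $[a]$, $a \geq 1$. Invariant: an endomorphism $x$ of a finite-dimensional $K$-vector space $V$ is $f$-primary if its minimal polynomial is a power of $f$. For such $x$, with $m = \dim_K V/\deg f$, the partition $\operatorname{inv} x \in \mathrm{Part}_m$ is the decreasing sequence of exponents of $f$ in the invariant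 factors of $x$, i.e. $V \cong \bigoplus_{i\ge 1} K[T]/(f^{\operatorname{inv}_i x})$ as $K[T]$-modules with $T$ acting through $x$. Type: let $s, n \colon V \to V$ be $K$-linear with $s \circ n = n \circ s$, $n$ nilpotent, and $s$ having minimal polynomial $f$ (for $V = 0$, the unique pair $(0,0)$ is allowed). Put $L = K[S]/(f(S))$; letting $S$ act through $s$ makes $V$ an $L$-vector space of dimension $m = \dim_K V / \deg f$ and $n$ is an $L$-linear nilpotent endomorphism. Then $\operatorname{typ}(s,n) \in \mathrm{Part}_m$ is the partition given by the exponents of the invariant factors of $n$ over $L$ (powers of $T$), i.e. by the sizes of the Jordan blocks of $n$ over $L$. Definition of $\zeta_f$: both $\operatorname{inv}$ (on $f$-primary $x$) and $\operatorname{typ}$ (on pairs $(s,n)$ of $K$-linear endomorphisms of $V$ with $s \circ n = n \circ s$, $n$ nilpotent, and $s$ having minimal polynomial $f$, where for $V = 0$ the unique pair $(0,0)$ is allowed) induce bijections from $\operatorname{Aut}_K(V)$-conjugacy classes to $\mathrm{Part}_m$, and $(s,n) \mapsto s+n$ is conjugation-equivariant with $s + n$ being $f$-primary. The map $\zeta_f \colon \mathrm{Part} \to \mathrm{Part}$ is the unique map such that $\operatorname{inv}(s+n) = \zeta_f(\operatorname{typ}(s,n))$ for all finite-dimensional $V$ with $\deg f \mid \dim_K V$ and all such pairs $(s,n)$ on $V$. It restricts to maps $\mathrm{Part}_m \to \mathrm{Part}_m$ and, by compatibility of $\operatorname{inv}$ and $\operatorname{typ}$ with direct sums, is a homomorphism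 of commutative monoids. *)

(* Defs.v *)
(* MathComp *)
From HB Require Import structures.
From mathcomp Require Import all_boot all_order all_algebra.

Set Implicit Arguments.
Unset Strict Implicit.
Unset Printing Implicit Defensive.

Import GRing.Theory.
Local Open Scope ring_scope.

(* A decreasing, eventually zero map phi from {1, 2, ...} to nat is encoded by
   the list [:: phi_1; ...; phi_r] of its nonzero values.                     *)
Definition is_part (s : seq nat) : bool :=
  sorted geq s && all (fun i => 0 < i)%N s.

Record part := Part { parts :> seq nat; _ : is_part parts }.
HB.instance Definition _ := [isSub for parts].
HB.instance Definition _ := [Choice of part by <:].

Lemma geq_total : total geq.
Proof. by move=> m n; exact: leq_total. Qed.
Lemma geq_trans : transitive geq.
Proof. by move=> n m p /= nm pn; exact: leq_trans pn nm. Qed.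
Lemma geq_anti : antisymmetric geq.
Proof. by move=> m n; rewrite andbC; exact: anti_leq. Qed.

Lemma mkpart_subproof (s : seq nat) :
  is_part (sort geq [seq i <- s | 0 < i]%N).
Proof.
by rewrite /is_part sort_sorted ?all_sort ?filter_all //; exact: geq_total.
Qed.

(* The partition [s_1, ..., s_r]: the order of the entries is irrelevant and
   zero entries are dropped.                                                  *)
Definition mkpart (s : seq nat) : part := Part (mkpart_subproof s).

Definition single (a : nat) : part := mkpart [:: a].

(* The additive structure on part is splicing, i.e. the union of multisets.   *)
Definition part_add (p1 p2 : part) : part := mkpart (p1 ++ p2).

Lemma part_perm (p1 p2 : part) : perm_eq p1 p2 -> p1 = p2.
Proof.
move=> eq12; apply: val_inj.
have /andP[s1 _] := valP p1; have /andP[s2 _] := valP p2.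
exact: (sorted_eq geq_trans geq_anti s1 s2 eq12).
Qed.

Lemma part_add_perm (p1 p2 : part) : perm_eq (part_add p1 p2) (p1 ++ p2).
Proof.
have /andP[_ pos1] := valP p1; have /andP[_ pos2] := valP p2.
rewrite perm_sort (_ : filter _ _ = p1 ++ p2) //.
by apply/all_filterP; rewrite all_cat pos1.
Qed.

Lemma part_addA : associative part_add.
Proof.
move=> p1 p2 p3; apply: part_perm.
rewrite (perm_trans (part_add_perm _ _)) // perm_sym.
rewrite (perm_trans (part_add_perm _ _)) // perm_sym.
rewrite (perm_trans _ (_ : perm_eq (p1 ++ (p2 ++ p3)) _)) //.
  by rewrite perm_cat2l part_add_perm.
by rewrite catA perm_cat2r perm_sym part_add_perm.
Qed.

Lemma part_addC : commutative part_add.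
Proof.
move=> p1 p2; apply: part_perm.
rewrite (perm_trans (part_add_perm _ _)) // perm_sym.
by rewrite (perm_trans (part_add_perm _ _)) // perm_catC.
Qed.

Lemma part_add0 : left_id (mkpart [::]) part_add.
Proof. by move=> p; apply: part_perm; exact: part_add_perm. Qed.

HB.instance Definition _ :=
  GRing.isNmodule.Build part part_addA part_addC part_add0.

Section Endomorphisms.
Context (K : fieldType) (V : vectType K).
Implicit Types (f g p : {poly K}) (x s n : 'End(V)) (lam : part).

(* The vector g(x) v. 'End(V) carries no canonical ring structure, since V may
   be 0.                                                                      *)
Definition poly_act x g (v : V) : V :=
  \sum_(i < size g) g`_i *: iter i x v.

Definition is_minpoly x p : Prop :=
  p \is monic /\ forall g, (forall v, poly_act x g v = 0) <-> p %| g.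

Definition primary f x : Prop := exists e : nat, is_minpoly x (f ^+ e).

(* has_inv f x lam says that x is f-primary with inv x = lam. The K[T]-linear
   isomorphism phi goes from V to the direct sum of the K[T]/(f ^ lam_i);
   {poly %/ h} is K[T]/(h) when h is monic and nonconstant, which holds here
   for f monic irreducible since the entries of lam are positive.             *)
Definition has_inv f x lam : Prop :=
  primary f x /\
  exists phi : V ->
      {dffun forall i : 'I_(size lam), {poly %/ f ^+ nth 0%N lam i}},
    [/\ bijective phi,
        forall i u v, phi (u + v) i = phi u i + phi v i
      & forall i g v,
          phi (poly_act x g v) i = in_qpoly (f ^+ nth 0%N lam i) g * phi v i].

Definition nilpotent_end n : Prop := exists e : nat, forall v, iter e n v = 0.

(* On V = 0 the only pair (0, 0) is allowed, although the minimal polynomial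
   of 0 is then 1 rather than f.                                              *)
Definition jordan_pair f s n : Prop :=
  [/\ (s \o n)%VF = (n \o s)%VF, nilpotent_end n
    & \dim {:V} = 0%N \/ is_minpoly s f].

(* has_typ f s n lam says that typ(s, n) = lam. With L = K[S]/(f) and g(S)
   acting on V as g(s), psi is an L[T]-linear isomorphism from V, where T acts
   as n, to the direct sum of the L[T]/(T ^ lam_i).                           *)
Definition has_typ f s n lam : Prop :=
  exists psi : V ->
      {dffun forall i : 'I_(size lam),
         {poly %/ ('X^(nth 0%N lam i) : {poly {poly %/ f}})}},
    [/\ bijective psi,
        forall i u v, psi (u + v) i = psi u i + psi v i,
        forall i g v, psi (poly_act s g v) i = in_qpoly f g *: psi v i
      & forall i v, psi (n v) i = 'qX * psi v i].

End Endomorphisms.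

(* The property inv (s + n) = zeta (typ (s, n)), which characterizes zeta_f.  *)
Definition is_zeta (K : fieldType) (f : {poly K}) (zeta : part -> part) : Prop :=
  forall (V : vectType K) (s n : 'End(V)) (lam : part),
    ((size f).-1 %| \dim {:V})%N -> jordan_pair f s n ->
    has_typ f s n lam -> has_inv f (s + n) (zeta lam).

(* Kbar is meant to be an algebraic closure of K through iota.                *)
Definition is_insep_degree (K : fieldType) (Kbar : closedFieldType)
    (iota : {rmorphism K -> Kbar}) (f : {poly K}) (q : nat) : Prop :=
  forall z : Kbar, root (map_poly iota f) z -> mup z (map_poly iota f) = q.

(* Main.v *)
(** Let L = K[S]/(f) and let theta be the class of S. On a summand L[T]/(T^a),
    with s = theta and n = T, the endomorphism x = s + n is multiplication by
    theta + T, and the Taylor expansion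
      f(theta + T) = \sum_i f^`N(i)(theta) T^i
    starts in degree q, because theta has multiplicity q as a root of f. Hence
    f(x) is T^q times a unit, so T^c with c < q is killed by f(x)^e as soon as
    q e + c >= a, i.e. for e = k + 1 if c < l and e = k otherwise, where
    a = k q + l. The elements T^c, c < q, generate the summand over K[x] by
    descending induction on the T-adic valuation, and these exponents add up to
    a, so comparing dimensions makes the sum of the cyclic K[x]-modules that
    they generate direct. *)
From HB Require Import structures.
Require Import Defs.
From mathcomp Require Import all_boot all_order all_algebra.

Set Implicit Arguments.
Unset Strict Implicit.
Unset Printing Implicit Defensive.

Import GRing.Theory.
Local Open Scope ring_scope.

(** * The action of K[X] through an endomorphism *)

Section PolyAct.
Context (K : fieldType) (V : vectType K).
Implicit Types (g h : {poly K}) (x : 'End(V)) (v : V).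

(** Any bound on the degree may replace [size g], so polynomials of different sizes can be summed
    over one range. *)
Lemma poly_actE x g v (m : nat) : (size g <= m)%N ->
  poly_act x g v = \sum_(i < m) g`_i *: iter i x v.
Proof.
move=> le_gm; rewrite /poly_act (big_ord_widen _ (fun i => g`_i *: iter i x v) le_gm).
rewrite big_mkcond; apply: eq_bigr => i _.
by case: ltnP => // le_gi; rewrite nth_default ?scale0r.
Qed.

Fact poly_act_is_linear x g : linear (poly_act x g).
Proof.
have iter_lin i : linear (iter i x).
  by elim: i => [|i IHi] a u v //=; rewrite IHi linearP.
move=> a u v; rewrite /poly_act scaler_sumr -big_split; apply: eq_bigr => i _ /=.
by rewrite iter_lin scalerDr !scalerA mulrC.
Qed.

HB.instance Definition _ x g :=
  GRing.isLinear.Build K V V *:%R (poly_act x g) (poly_act_is_linear x g).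

Lemma poly_act_linearl x v : linear (fun g => poly_act x g v).
Proof.
move=> a g h; set m := maxn (size (a *: g + h)) (maxn (size g) (size h)).
rewrite !(@poly_actE x _ v m) ?leq_max ?leqnn ?orbT //.
rewrite scaler_sumr -big_split; apply: eq_bigr => i _ /=.
by rewrite coefD coefZ scalerDl scalerA.
Qed.

Lemma poly_act0l x v : poly_act x 0 v = 0.
Proof. by rewrite /poly_act size_poly0 big_ord0. Qed.

Lemma poly_actZl x a g v : poly_act x (a *: g) v = a *: poly_act x g v.
Proof. by have := poly_act_linearl x v a g 0; rewrite poly_act0l !addr0. Qed.

Lemma poly_actDl x g h v : poly_act x (g + h) v = poly_act x g v + poly_act x h v.
Proof. by have := poly_act_linearl x v 1 g h; rewrite !scale1r. Qed.

Lemma poly_actBl x g h v : poly_act x (g - h) v = poly_act x g v - poly_act x h v.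
Proof. by rewrite -scaleN1r poly_actDl poly_actZl scaleN1r. Qed.

Lemma poly_act_suml x I r (P : pred I) (F : I -> {poly K}) v :
  poly_act x (\sum_(i <- r | P i) F i) v = \sum_(i <- r | P i) poly_act x (F i) v.
Proof.
by apply: (big_morph (fun g => poly_act x g v) _ (poly_act0l x v)) => g h;
  exact: poly_actDl.
Qed.

Lemma poly_actC x a v : poly_act x a%:P v = a *: v.
Proof. by rewrite (@poly_actE x _ v 1) ?size_polyC_leq1 // big_ord1 coefC. Qed.

Lemma poly_actXn x i v : poly_act x 'X^i v = iter i x v.
Proof.
rewrite /poly_act size_polyXn big_ord_recr /= coefXn eqxx scale1r big1 ?add0r //.
by move=> j _; rewrite coefXn ltn_eqF // scale0r.
Qed.

Lemma poly_actX x v : poly_act x 'X v = x v.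
Proof. exact: (poly_actXn x 1). Qed.

Lemma poly_actM x g h v : poly_act x (g * h) v = poly_act x g (poly_act x h v).
Proof.
have actXM p u : poly_act x ('X * p) u = x (poly_act x p u).
  rewrite (@poly_actE x _ u (size p).+1); last first.
    by rewrite (leq_trans (size_polyMleq _ _)) ?size_polyX.
  rewrite big_ord_recl coefXM eqxx scale0r add0r linear_sum.
  by apply: eq_bigr => i _; rewrite coefXM linearZ.
elim/poly_ind: g h v => [|g c IHg] h v; first by rewrite mul0r !poly_act0l.
rewrite mulrDl -mulrA !poly_actDl IHg actXM [in RHS]IHg poly_actX mul_polyC.
by rewrite poly_actZl poly_actC.
Qed.

End PolyAct.

(** * Decompositions into cyclic K[X]-modules *)

Section FiniteFamily.
Context (K : fieldType) (V : vectType K) (I : finType) (b : I -> V).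

(** Coordinates are indexed by a finite type, since the bases below consist of vectors X^i w_t
    indexed by dependent pairs. *)
Lemma mem_span_family u :
  u \in <<codom b>>%VS <-> exists c : I -> K, u = \sum_i c i *: b i.
Proof.
split=> [|[c ->]]; last first.
  by apply: memv_suml => i _; apply/memvZ/memv_span/codom_f.
move=> /(@coord_span _ _ _ (codom_tuple b)) ->.
exists (fun i => coord (codom_tuple b) (enum_rank i) u).
rewrite (reindex _ (onW_bij _ (enum_rank_bij I))) /=.
by apply: eq_bigr => i _; rewrite nth_codom enum_rankK.
Qed.

Lemma free_familyP :
  reflect (forall c : I -> K, \sum_i c i *: b i = 0 -> forall i, c i = 0)
          (free (codom b)).
Proof.
apply: (iffP (@freeP _ _ _ (codom_tuple b))) => indep c.
  move=> c0 i; rewrite -[i]enum_rankK; apply: (indep (c \o enum_val)) => /=.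
  rewrite -[RHS]c0 [RHS](reindex _ (onW_bij _ (enum_val_bij I))).
  by apply: eq_bigr => j _; rewrite nth_codom.
move=> c0 j; rewrite -[j]enum_valK; apply: (indep (c \o enum_rank)) => /=.
rewrite -[RHS]c0 (reindex _ (onW_bij _ (enum_rank_bij I))) /=.
by apply: eq_bigr => i _; rewrite nth_codom enum_rankK.
Qed.

End FiniteFamily.

Lemma size_sum_monomials (R : nzRingType) m (F : 'I_m -> R) :
  (size (\sum_(i < m) F i *: 'X^i)%R <= m)%N.
Proof.
apply: (leq_trans (size_sum _ _ _)); apply/bigmax_leqP => i _.
by rewrite (leq_trans (size_scale_leq _ _)) // size_polyXn.
Qed.

Lemma coef_sum_monomials (R : nzRingType) m (F : 'I_m -> R) (j : 'I_m) :
  (\sum_(i < m) F i *: 'X^i)`_j = F j.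
Proof.
rewrite coef_sum (bigD1 j) //= coefZ coefXn eqxx mulr1 big1 ?addr0 // => i ij.
by rewrite coefZ coefXn eq_sym (inj_eq val_inj) (negPf ij) mulr0.
Qed.

Lemma poly_sum_monomials (R : nzRingType) m (p : {poly R}) :
  (size p <= m)%N -> p = \sum_(i < m) p`_i *: 'X^i.
Proof.
move=> le_pm; rewrite -poly_def; apply/polyP => i; rewrite coef_poly.
by case: ltnP => // le_mi; rewrite nth_default // (leq_trans le_pm).
Qed.

Lemma big_tagged_scale (K : fieldType) (V : vectType K) (T : finType)
    (m : T -> nat) (b : T -> nat -> V) (c : {t : T & 'I_(m t)} -> K) :
  \sum_p c p *: b (tag p) (tagged p) =
  \sum_t \sum_(i < m t) c (Tagged (fun t => 'I_(m t)) i) *: b t i.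
Proof. by rewrite sig_big_dep; apply: eq_bigr => -[]. Qed.

Lemma card_tagged_ord (T : finType) (m : T -> nat) :
  #|{: {t : T & 'I_(m t)}}| = (\sum_t m t)%N.
Proof.
rewrite card_tagged sumnE big_map big_enum.
by apply: eq_bigr => t _; rewrite card_ord.
Qed.

Section CyclicDecomposition.
Context (K : fieldType) (V : vectType K) (f : {poly K}) (x : 'End(V)).
Hypothesis f_monic : f \is monic.

Local Notation d := (size f).-1.

(** V is the internal direct sum of the K[x] w_t, each isomorphic to K[X]/(f^(e_t)). The value e_t =
    0 is allowed and forces w_t = 0. *)
Definition cyclic_decomp (T : finType) (w : T -> V) (e : T -> nat) : Prop :=
  [/\ forall t, poly_act x (f ^+ e t) (w t) = 0,
      forall v, exists g : T -> {poly K}, v = \sum_t poly_act x (g t) (w t)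
    & forall g : T -> {poly K}, \sum_t poly_act x (g t) (w t) = 0 ->
        forall t, f ^+ e t %| g t].

Lemma size_fX n : size (f ^+ n) = (d * n).+1.
Proof.
by rewrite -size_exp prednK // size_poly_gt0 expf_neq0 // monic_neq0.
Qed.

Lemma fX_neq0 n : f ^+ n != 0.
Proof. by rewrite -size_poly_eq0 size_fX. Qed.

Lemma size_modfX g n : (size (g %% f ^+ n)%R <= d * n)%N.
Proof. by rewrite -ltnS -size_fX ltn_modp fX_neq0. Qed.

Lemma poly_act_mod g h v :
  poly_act x h v = 0 -> poly_act x (g %% h) v = poly_act x g v.
Proof.
by move=> hv; rewrite {2}(divp_eq g h) poly_actDl poly_actM hv raddf0 add0r.
Qed.

Lemma sum_poly_act_monomials (T : finType) (w : T -> V) (m : T -> nat) h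
    (c : {t : T & 'I_(m t)} -> K) :
  \sum_p c p *: poly_act x (h * 'X^(tagged p)) (w (tag p)) =
  \sum_t poly_act x
    (h * \sum_(i < m t) c (Tagged (fun t => 'I_(m t)) i) *: 'X^i) (w t).
Proof.
rewrite (big_tagged_scale (fun t i => poly_act x (h * 'X^i) (w t))).
apply: eq_bigr => t _; rewrite mulr_sumr poly_act_suml.
by apply: eq_bigr => i _; rewrite -scalerAr poly_actZl.
Qed.

(** The vectors x^i w_t with i < d e_t span V, and there are at most dim V of them, so they form a
    basis. Generation is phrased through subspaces containing every K[x] w_t, the form in which an
    induction can verify it. *)
Lemma cyclic_decomp_generators (T : finType) (w : T -> V) (e : T -> nat) :
    (forall t, poly_act x (f ^+ e t) (w t) = 0) ->
    (forall U : {vspace V},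
       (forall t g, poly_act x g (w t) \in U) -> U = fullv) ->
    (d * \sum_t e t <= \dim {:V})%N ->
  cyclic_decomp w e.
Proof.
move=> annih gens dimV; pose m t := (d * e t)%N.
(* The factor [1] matches the shape [h * 'X^i] of [sum_poly_act_monomials]. *)
pose b (p : {t : T & 'I_(m t)}) := poly_act x (1 * 'X^(tagged p)) (w (tag p)).
have spanE (u : V) : u \in <<codom b>>%VS <-> exists2 g : T -> {poly K},
    forall t, (size (g t) <= m t)%N & u = \sum_t poly_act x (g t) (w t).
  split=> [/mem_span_family[c ->]|[g le_gm ->]].
    rewrite sum_poly_act_monomials.
    exists (fun t => \sum_(i < m t) c (Tagged (fun t => 'I_(m t)) i) *: 'X^i).
      by move=> t; exact: size_sum_monomials.
    by apply: eq_bigr => t _; rewrite mul1r.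
  apply/mem_span_family.
  exists (fun p : {t : T & 'I_(m t)} => (g (tag p))`_(tagged p)).
  rewrite sum_poly_act_monomials.
  by apply: eq_bigr => t _; rewrite mul1r /= -poly_sum_monomials.
have spanV : <<codom b>>%VS = fullv.
  apply: gens => t g; apply/spanE.
  exists (fun t' => if t' == t then g %% f ^+ e t else 0) => [t'|].
    by case: eqP => [->|_]; rewrite ?size_poly0 ?size_modfX.
  rewrite (bigD1 t) //= eqxx poly_act_mod // big1 ?addr0 // => t' /negPf ->.
  exact: poly_act0l.
have freeb : free (codom b).
  rewrite /free spanV eqn_leq {1}(leq_trans _ (dim_span (codom b))) ?spanV //=.
  by rewrite size_codom card_tagged_ord -big_distrr.
split=> // [v|g g0 t].
  by have /spanE[g _ vE] : v \in <<codom b>>%VS; [rewrite spanV memvf | exists g].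
(* The remainders of the [g t] modulo f^(e_t) satisfy the same relation, and freeness makes their
   coefficients vanish. *)
rewrite /dvdp; apply/eqP/polyP => i; rewrite coef0.
case: (ltnP i (m t)) => [lt_im|le_mi]; last first.
  by rewrite nth_default // (leq_trans (size_modfX _ _)).
pose c (p : {t : T & 'I_(m t)}) := (g (tag p) %% f ^+ e (tag p))`_(tagged p).
suff c0 p : c p = 0 by exact: (c0 (Tagged (fun t => 'I_(m t)) (Ordinal lt_im))).
move: p; apply: (elimT (free_familyP b) freeb); rewrite sum_poly_act_monomials.
rewrite -[RHS]g0; apply: eq_bigr => t' _; rewrite mul1r /c /= -poly_sum_monomials.
  by rewrite poly_act_mod.
exact: size_modfX.
Qed.

(** f(x)^j maps the summand K[X]/(f^e) onto a copy of K[X]/(f^(e-j)), with basis f^j X^i w_t for i <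
    d (e - j); truncated subtraction covers e <= j. *)
Lemma dim_range_poly_act (T : finType) (w : T -> V) (e : T -> nat) j :
  cyclic_decomp w e ->
  \dim (limg (linfun (poly_act x (f ^+ j)))) = (d * \sum_t (e t - j))%N.
Proof.
move=> [annih gens indep]; pose m t := (d * (e t - j))%N.
pose b (p : {t : T & 'I_(m t)}) :=
  poly_act x (f ^+ j * 'X^(tagged p)) (w (tag p)).
suff [freeb <-] : free (codom b) /\
    <<codom b>>%VS = limg (linfun (poly_act x (f ^+ j))).
  by rewrite (eqnP freeb) size_codom card_tagged_ord -big_distrr.
split.
  apply/free_familyP => c; rewrite sum_poly_act_monomials => /indep cdvd [t i].
  rewrite -(coef_sum_monomials (fun i => c (Tagged (fun t => 'I_(m t)) i)) i).
  set p := \sum_(_ < _) _; suff -> : p = 0 by rewrite coef0.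
  have le_pm : (size p <= m t)%N by exact: size_sum_monomials.
  have : f ^+ (e t - j) %| p.
    have := cdvd t; case: (leqP j (e t)) => [le_je|/ltnW]; last first.
      by rewrite -subn_eq0 => /eqP->; rewrite expr0 dvd1p.
    by rewrite -{1}(subnKC le_je) exprD dvdp_mul2l ?fX_neq0.
  case: (eqVneq p 0) => // p0 /(dvdp_leq p0).
  by rewrite size_fX ltnNge le_pm.
apply/vspaceP => u; apply/idP/idP.
  move=> /mem_span_family[c ->]; apply: memv_suml => p _; apply: memvZ.
  apply/memv_imgP; exists (poly_act x 'X^(tagged p) (w (tag p))); first exact: memvf.
  by rewrite lfunE /= -poly_actM.
move=> /memv_imgP[v _ ->]; rewrite lfunE /=; have [g ->] := gens v.
apply/mem_span_family.
exists (fun p : {t : T & 'I_(m t)} => (g (tag p) %% f ^+ (e (tag p) - j))`_(tagged p)).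
rewrite sum_poly_act_monomials raddf_sum; apply: eq_bigr => t _ /=.
rewrite -poly_sum_monomials ?size_modfX // -poly_actM.
rewrite {1}(divp_eq (g t) (f ^+ (e t - j))) mulrDr poly_actDl.
suff -> : poly_act x (f ^+ j * (g t %/ f ^+ (e t - j) * f ^+ (e t - j))) (w t) = 0.
  by rewrite add0r.
(* In truncated arithmetic j + (e - j) = max(j, e) = (j - e) + e, so the factor f^e, which kills
   w_t, splits off. *)
rewrite mulrCA -exprD -maxnE maxnC maxnE addnC exprD !mulrA poly_actM annih.
exact: raddf0.
Qed.

End CyclicDecomposition.

(** * The invariant of a primary endomorphism *)

Lemma in_qpoly_val (R : nzRingType) (h : {poly R}) (y : {poly %/ h}) :
  in_qpoly h y = y.
Proof. by apply/val_inj/in_qpoly_small/size_mk_monic. Qed.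

Lemma in_qpolyB (R : nzRingType) (h p g : {poly R}) :
  in_qpoly h (p - g) = in_qpoly h p - in_qpoly h g.
Proof. exact: raddfB. Qed.

Lemma in_qpolyC (R : nzRingType) (h : {poly R}) c : in_qpoly h c%:P = qpolyC h c.
Proof.
apply/val_inj/in_qpoly_small.
by rewrite (leq_ltn_trans (size_polyC_leq1 _)) ?size_mk_monic_gt1.
Qed.

(** For [h] monic and nonconstant, [mk_monic h] is [h] itself, so the modulus of [{poly %/ h}] is
    [h] and not the default. *)
Lemma in_qpoly_eq0 (K : fieldType) (h g : {poly K}) :
  h \is monic -> (1 < size h)%N -> (in_qpoly h g == 0) = (h %| g).
Proof.
move=> h_monic h_gt1; rewrite -val_eqE /= /mk_monic h_gt1 h_monic /=.
by rewrite -Pdiv.IdomainMonic.modpE.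
Qed.

Lemma nth_part_gt0 (lam : part) i : (i < size lam)%N -> (0 < nth 0%N lam i)%N.
Proof. by have /andP[_ /all_nthP] := valP lam; apply. Qed.

Lemma nth_part_leq (lam : part) i j :
  (i <= j)%N -> (nth 0 lam j <= nth 0 lam i)%N.
Proof.
have /andP[lam_sorted _] := valP lam => le_ij.
case: (ltnP j (size lam)) => [lt_j|]; last by move/(nth_default _)->.
exact: (sorted_leq_nth geq_trans leqnn 0%N lam_sorted i j
         (leq_ltn_trans le_ij lt_j) lt_j le_ij).
Qed.

Lemma parts_mkpart (s : seq nat) :
  (mkpart s : seq nat) = sort geq [seq a <- s | 0 < a]%N.
Proof. by []. Qed.

Lemma mkpartE (s : seq nat) : mkpart s = \sum_(a <- s) single a.
Proof.
elim: s => [|a s IHs]; first by rewrite big_nil.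
rewrite big_cons -IHs; apply: part_perm.
rewrite perm_sym (perm_trans (part_add_perm _ _)) // !parts_mkpart.
rewrite perm_sym perm_sort -cat1s filter_cat; apply: perm_cat.
  by rewrite perm_sym perm_sort.
by rewrite perm_sym perm_sort.
Qed.

Section Invariant.
Context (K : fieldType) (V : vectType K) (f : {poly K}) (x : 'End(V)).
Hypothesis f_monic : f \is monic.
Hypothesis f_nonconst : (1 < size f)%N.

Lemma in_qpolyfX_eq0 e g : (0 < e)%N ->
  (in_qpoly (f ^+ e) g == 0) = (f ^+ e %| g).
Proof.
move=> e_gt0; apply: in_qpoly_eq0; first exact: monic_exp.
by rewrite size_fX // ltnS muln_gt0 e_gt0 andbT -ltnS prednK // ltnW.
Qed.

Lemma has_inv_cyclic_decomp (lam : part) :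
  has_inv f x lam ->
  exists w : 'I_(size lam) -> V,
    cyclic_decomp f x w (fun i : 'I_(size lam) => nth 0%N lam i).
Proof.
move=> [_ [phi [[psi phiK psiK] phiD phiM]]].
have phi_inj := can_inj phiK.
have phi0 k : phi 0 k = 0 by apply: (addIr (phi 0 k)); rewrite -phiD !add0r.
(* The generators are the preimages of the unit vectors of the direct sum. *)
pose w (i : 'I_(size lam)) := psi [ffun k : 'I_(size lam) =>
  (if k == i then 1 else 0) : {poly %/ f ^+ nth 0%N lam k}].
have phi_sum g k :
    phi (\sum_i poly_act x (g i) (w i)) k = in_qpoly (f ^+ nth 0%N lam k) (g k).
  rewrite (big_morph (fun v => phi v k) (phiD k) (phi0 k)) (bigD1 k) //=.
  rewrite phiM psiK ffunE eqxx mulr1 big1 ?addr0 // => i /negPf ik.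
  by rewrite phiM psiK ffunE eq_sym ik mulr0.
exists w; split=> [i|v|g g0 i].
- apply: phi_inj; apply/ffunP => k; rewrite phi0 phiM psiK ffunE.
  case: eqP => [->|_]; last by rewrite mulr0.
  by rewrite mulr1; apply/eqP; rewrite in_qpolyfX_eq0 // nth_part_gt0.
- exists (fun i => phi v i); apply: phi_inj; apply/ffunP => k.
  by rewrite phi_sum in_qpoly_val.
- rewrite -in_qpolyfX_eq0 ?nth_part_gt0 //.
  by rewrite -phi_sum g0 phi0.
Qed.

Lemma cyclic_decomp_has_inv (lam : part) (w : 'I_(size lam) -> V) :
  cyclic_decomp f x w (fun i : 'I_(size lam) => nth 0%N lam i) ->
  has_inv f x lam.
Proof.
move=> [annih gens indep]; split.
  (* The first part is the largest and gives the minimal polynomial; for the empty partition the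
     default [0] gives f^0 = 1. *)
  exists (nth 0%N lam 0); split=> [|g]; first exact: monic_exp.
  split=> [g0|dvd_g v].
    case: (posnP (size lam)) => [/size0nil->|lam_gt0].
      by rewrite /= expr0 dvd1p.
    (* Placing [g] on the first generator alone is a relation, so independence gives divisibility by
       the largest power of f. *)
    apply: (indep (fun i => if i == Ordinal lam_gt0 then g else 0)
                  _ (Ordinal lam_gt0)) => //=.
    rewrite big1 // => i _; case: ifP => _; rewrite ?g0 ?poly_act0l //.
  have [h ->] := gens v; rewrite raddf_sum big1 // => i _ /=.
  have : f ^+ nth 0%N lam i %| g.
    by apply: dvdp_trans dvd_g; apply/dvdp_exp2l/nth_part_leq.
  rewrite -poly_actM mulrC dvdp_eq => /eqP->.
  by rewrite mulrA poly_actM annih raddf0.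
pose D := {dffun forall i : 'I_(size lam), {poly %/ f ^+ nth 0%N lam i}}.
(* The isomorphism is built backwards: [Psi] applies representatives to the generators and is shown
   to be bijective. *)
pose Psi (y : D) := \sum_i poly_act x (y i) (w i).
have act_val (i : 'I_(size lam)) (g : {poly K}) :
    poly_act x (in_qpoly (f ^+ nth 0%N lam i) g) (w i) = poly_act x g (w i).
  apply/eqP; rewrite -subr_eq0 -poly_actBl; apply/eqP.
  have: f ^+ nth 0%N lam i %|
      (in_qpoly (f ^+ nth 0%N lam i) g : {poly K}) - g.
    by rewrite -in_qpolyfX_eq0 ?nth_part_gt0 // in_qpolyB in_qpoly_val subrr.
  by rewrite dvdp_eq => /eqP->; rewrite poly_actM annih raddf0.
have Psi_inj : injective Psi.
  move=> y z /eqP; rewrite -subr_eq0 -sumrB => /eqP yz; apply/ffunP => i.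
  apply/eqP; rewrite -subr_eq0 -[_ - _]in_qpoly_val.
  rewrite in_qpolyfX_eq0 ?nth_part_gt0 //.
  apply: (indep (fun i => (y i - z i)%R : {poly K})).
  by rewrite -[RHS]yz; apply: eq_bigr => k _; rewrite -poly_actBl.
have Psi_surj v : exists y : D, Psi y == v.
  have [g ->] := gens v; exists [ffun i => in_qpoly _ (g i)].
  by apply/eqP; apply: eq_bigr => i _; rewrite ffunE act_val.
pose phi v : D := xchoose (Psi_surj v).
have phiK : cancel phi Psi by move=> v; exact/eqP/(xchooseP (Psi_surj v)).
have PsiK : cancel Psi phi by move=> y; apply: Psi_inj; rewrite phiK.
exists phi; split; first by exists Psi.
- move=> i u v; pose z : D := [ffun k => phi u k + phi v k].
  suff -> : u + v = Psi z by rewrite PsiK ffunE.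
  rewrite -{1}[u]phiK -{1}[v]phiK -big_split; apply: eq_bigr => k _ /=.
  by rewrite ffunE -poly_actDl.
- move=> i g v; pose z : D := [ffun k => in_qpoly _ g * phi v k].
  suff -> : poly_act x g v = Psi z by rewrite PsiK ffunE.
  rewrite -{1}[v]phiK raddf_sum; apply: eq_bigr => k _ /=.
  rewrite -poly_actM ffunE -[phi v k in RHS]in_qpoly_val -in_qpolyM.
  by rewrite act_val.
Qed.

(** Exponents e_t = 0 are allowed: their generators vanish and [single 0] is neutral. The remaining
    indices are sorted by e_t to match the decreasing list [lam]. *)
Lemma has_inv_generators (T : finType) (w : T -> V) (e : T -> nat) :
    (forall t, poly_act x (f ^+ e t) (w t) = 0) ->
    (forall U : {vspace V},
       (forall t g, poly_act x g (w t) \in U) -> U = fullv) ->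
    ((size f).-1 * \sum_t e t <= \dim {:V})%N ->
  has_inv f x (\sum_t single (e t)).
Proof.
move=> annih gens dimV; set lam := \sum_t _.
pose s := sort (relpre e geq) [seq t <- enum T | 0 < e t]%N.
have mem_s t : (t \in s) = (0 < e t)%N by rewrite mem_sort mem_filter mem_enum andbT.
have lamE : lam = [seq e t | t <- s] :> seq nat.
  rewrite /lam -big_enum -(big_map e xpredT single) -mkpartE parts_mkpart.
  by rewrite filter_map sort_map.
have size_s : size lam = size s by rewrite lamE size_map.
pose u (i : 'I_(size lam)) := tnth (in_tuple s) (cast_ord size_s i).
have eu (i : 'I_(size lam)) : nth 0%N lam i = e (u i).
  have lt_is : (i < size s)%N by rewrite -size_s.
  transitivity (nth 0%N [seq e t | t <- s] i); first by rewrite -[in RHS]lamE.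
  by rewrite (nth_map (u i)) // {2}/u (tnth_nth (u i)).
apply: (@cyclic_decomp_has_inv lam (w \o u)).
apply: cyclic_decomp_generators => // [i|U genU|] /=.
- by rewrite eu annih.
- apply: gens => t g; case: (posnP (e t)) => [et0|et_gt0].
    have := annih t; rewrite et0 expr0 -[1]/(1%:P) poly_actC scale1r => ->.
    by rewrite raddf0 mem0v.
  have /tnthP[i ti] : t \in in_tuple s by rewrite /= mem_s.
  have := genU (cast_ord (esym size_s) i) g.
  by rewrite /= /u cast_ordKV -ti.
- apply: leq_trans dimV; rewrite leq_mul2l; apply/orP; right.
  have -> : (\sum_(i < size lam) nth 0 lam i = \sum_(a <- lam) a)%N.
    by rewrite [RHS](big_nth 0%N) big_mkord.
  rewrite lamE big_map.
  rewrite (perm_big _ (permEl (perm_sort (relpre e geq) _))) /=.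
  by rewrite big_filter big_enum_cond /= [leqRHS](bigID (fun t => 0 < e t)%N) leq_addr.
Qed.

(** The ranks of the f(x)^j determine the sums of the truncated lam_i - j. Successive differences
    count the parts > j, and differences of these counts are the multiplicities of the parts. *)
Lemma has_inv_inj (lam mu : part) :
  has_inv f x lam -> has_inv f x mu -> lam = mu.
Proof.
move=> /has_inv_cyclic_decomp[w wlam] /has_inv_cyclic_decomp[z zmu].
have d_gt0 : (0 < (size f).-1)%N by rewrite -ltnS prednK // ltnW.
have eq_sub j : (\sum_(a <- lam) (a - j) = \sum_(a <- mu) (a - j))%N.
  apply/eqP; rewrite -(eqn_pmul2l d_gt0) (big_nth 0%N) big_mkord.
  rewrite -(dim_range_poly_act f_monic j wlam) // (dim_range_poly_act f_monic j zmu) //.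
  by rewrite [X in _ == (_ * X)%N](big_nth 0%N) big_mkord.
(* Passing from j to j + 1 lowers a - j by 1 exactly for the parts a > j. *)
have count_gt (s : seq nat) j :
    (count (fun a => j < a) s + \sum_(a <- s) (a - j.+1) = \sum_(a <- s) (a - j))%N.
  elim: s => [|a s IHs]; first by rewrite !big_nil.
  rewrite !big_cons /= addnACA IHs; congr (_ + _)%N.
  case: ltnP => [lt_ja|le_aj]; first by rewrite subnS add1n prednK ?subn_gt0.
  by rewrite (eqP le_aj) (eqP (leqW le_aj)).
have eq_count_gt j : count (fun a => j < a)%N lam = count (fun a => j < a)%N mu.
  by apply: (@addIn (\sum_(a <- lam) (a - j.+1))%N); rewrite {2}eq_sub !count_gt.
have count_eq (s : seq nat) j :
    (count_mem j.+1 s + count (fun a => j.+1 < a) s = count (fun a => j < a) s)%N.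
  rewrite -count_predUI (@eq_count _ (predI _ _) pred0) ?count_pred0 ?addn0.
    by apply: eq_count => a /=; rewrite [in RHS]leq_eqVlt eq_sym.
  by move=> a /=; case: eqP => // ->; rewrite ltnn.
apply: part_perm; apply/allP => /= -[|j] _; apply/eqP.
  have no0 (p : part) : count_mem 0%N p = 0%N.
    apply/count_memPn/negP => p0.
    by have /andP[_ /allP/(_ _ p0)] := valP p.
  by rewrite !no0.
by apply: (@addIn (count (fun a => j.+1 < a)%N lam)); rewrite {2}eq_count_gt !count_eq.
Qed.

End Invariant.

(** * The expansion of f(theta + T) *)

(** Taylor expansion with divided (Hasse) derivatives, valid in every characteristic. *)
Lemma coef_comp_XaddC (R : comNzRingType) (p : {poly R}) z i :
  (p \Po ('X + z%:P))`_i = (p^`N(i)).[z].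
Proof.
rewrite /comp_poly addrC nderiv_taylor; last exact: mulrC.
rewrite size_map_polyC.
under eq_bigr => j _ do rewrite nderivn_map horner_map /= mul_polyC.
rewrite -(poly_def _ (fun j => p^`N(j).[z])) coef_poly; case: ltnP => // le_pi.
by rewrite nderivn_poly0 ?horner0.
Qed.

Section InseparabilityDegree.
Context (K : fieldType) (f : {poly K}) (f_irr : irreducible_poly f).
Context (Kbar : closedFieldType) (iota : {rmorphism K -> Kbar}) (z : Kbar).
Hypothesis fz : root (map_poly iota f) z.

(** Up to a scalar, f is the minimal polynomial of z: if it does not divide g it is coprime to g,
    also over [Kbar], and then z is no common root. *)
Lemma irreducible_dvdp_root g : (f %| g) = root (map_poly iota g) z.
Proof.
apply/idP/idP => [dvd_fg|gz].
  move: fz; rewrite !root_factor_theorem => /dvdp_trans; apply.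
  by rewrite dvdp_map.
apply/negPn; rewrite -irreducible_poly_coprime //; apply/negP => co_fg.
have : coprimep (map_poly iota f) (map_poly iota g) by rewrite coprimep_map.
by move=> /coprimep_root/(_ fz); rewrite (rootP gz) eqxx.
Qed.

(** Over [Kbar] write f = h (X - z)^q with h(z) nonzero. In f(X + z) = h(X + z) X^q the coefficient
    of X^i, the i-th divided derivative at z, vanishes for i < q and is h(z) for i = q. *)
Lemma dvdp_nderivn_mup i : (i <= mup z (map_poly iota f))%N ->
  (f %| f^`N(i)) = (i < mup z (map_poly iota f))%N.
Proof.
set fz' := map_poly iota f; set q := mup z fz' => le_iq.
have f0 : fz' != 0 by rewrite map_poly_eq0 irredp_neq0.
have /dvdpP[h fE] : ('X - z%:P) ^+ q %| fz' by rewrite -mup_geq.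
have hz : ~~ root h z.
  apply/negP; rewrite root_factor_theorem => /dvdpP[h' hE].
  have : (q < q)%N by rewrite {2}/q mup_geq // fE hE exprS -mulrA dvdp_mulIr.
  by rewrite ltnn.
rewrite irreducible_dvdp_root /root -nderivn_map -coef_comp_XaddC -/fz' fE.
rewrite comp_polyM rmorphXn /= comp_polyB comp_polyX comp_polyC addrK coefMXn.
case: ltnP => [_|le_qi]; first by rewrite eqxx.
have -> : i = q by apply/eqP; rewrite eqn_leq le_iq.
by rewrite subnn coef_comp_XaddC nderivn0; apply: negPf.
Qed.

End InseparabilityDegree.

Section Translate.
Context (K : fieldType) (f : {poly K}).
Local Notation L := {poly %/ f}.

(** The ring morphism sending g to g(theta + T) in L[T], where theta is the class ['qX] and T is the
    variable of L[T]. *)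
Definition translate (g : {poly K}) : {poly L} :=
  map_poly (qpolyC f) g \Po ('X + ('qX : L)%:P).

Fact translate_is_monoid_morphism : monoid_morphism translate.
Proof. by split=> [|g h]; rewrite /translate ?rmorph1 // !rmorphM. Qed.

Fact translate_is_zmod_morphism : zmod_morphism translate.
Proof. by move=> g h; rewrite /translate !rmorphB. Qed.

HB.instance Definition _ :=
  GRing.isZmodMorphism.Build {poly K} {poly L} translate
    translate_is_zmod_morphism.
HB.instance Definition _ :=
  GRing.isMonoidMorphism.Build {poly K} {poly L} translate
    translate_is_monoid_morphism.

Lemma translateX : translate 'X = 'X + ('qX : L)%:P.
Proof. by rewrite /translate map_polyX comp_polyX. Qed.

Lemma translateC c : translate c%:P = (qpolyC f c)%:P.
Proof. by rewrite /translate map_polyC comp_polyC. Qed.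

Lemma horner_map_qpolyC g : (map_poly (qpolyC f) g).['qX] = in_qpoly f g.
Proof.
elim/poly_ind: g => [|g c IHg]; first by rewrite rmorph0 horner0 in_qpoly0.
rewrite rmorphD rmorphM /= map_polyX map_polyC hornerMXaddC IHg.
by rewrite in_qpolyD in_qpolyM in_qpolyC.
Qed.

Lemma coef_translate g i : (translate g)`_i = in_qpoly f (g^`N(i)).
Proof. by rewrite coef_comp_XaddC nderivn_map horner_map_qpolyC. Qed.

Hypotheses (f_monic : f \is monic) (f_irr : irreducible_poly f).

(** The coefficient of T^i in f(theta + T) is the class of the i-th divided derivative: zero for i <
    q and a unit of L for i = q, with inverse from a Bezout relation. Only the constant term of u is
    inverted; the T-adic induction below absorbs the higher terms. *)
Lemma translate_self q :
    (forall i, (i < q)%N -> f %| f^`N(i)) -> ~~ (f %| f^`N(q)) ->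
  exists2 u : {poly L}, translate f = 'X^q * u & exists c, u`_0 * c = 1.
Proof.
move=> dvd_lt ndvd_q; exists (drop_poly q (translate f)).
  rewrite -{1}(poly_take_drop q (translate f)) [X in X + _](_ : _ = 0).
    by rewrite add0r mulrC.
  apply/polyP => i; rewrite coef_take_poly coef0; case: ltnP => // lt_iq.
  rewrite coef_translate; apply/eqP; rewrite in_qpoly_eq0 ?dvd_lt //.
  by have [] := f_irr.
have /Bezout_eq1_coprimepP[[a b] /= ab1] : coprimep f f^`N(q).
  by rewrite irreducible_poly_coprime.
exists (in_qpoly f b).
rewrite coef_drop_poly add0n coef_translate -in_qpolyM mulrC -in_qpoly1 -ab1.
rewrite in_qpolyD [in_qpoly f (a * f)](_ : _ = 0) ?add0r //.
apply/eqP; rewrite in_qpoly_eq0 ?dvdp_mulIr //; by have [] := f_irr.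
Qed.

End Translate.

(** * The invariant of s + n *)

Lemma mul_qpolyC (K : fieldType) (f : {poly K}) c (y : {poly %/ f}) :
  qpolyC f c * y = c *: y.
Proof.
rewrite -{1}[y]in_qpoly_val -in_qpolyC -in_qpolyM mul_polyC in_qpolyZ.
by rewrite in_qpoly_val.
Qed.

Lemma size_mk_monicXn (R : nzSemiRingType) a :
  (0 < a)%N -> size (mk_monic ('X^a : {poly R})) = a.+1.
Proof. by move=> a_gt0; rewrite mk_monic_Xn size_polyXn prednK. Qed.

Lemma in_qpolyXn_eq0 (R : comNzRingType) a b (y : {poly R}) :
  (0 < a)%N -> (a <= b)%N -> in_qpoly 'X^a ('X^b * y) = 0.
Proof.
move=> a_gt0 le_ab; apply: val_inj => /=.
rewrite mk_monic_Xn prednK // mulrC -(subnK le_ab) exprD mulrA.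
exact/Pdiv.RingMonic.rmodp_mull/monicXn.
Qed.

Lemma qpolyXn (R : comNzRingType) (h : {poly R}) b :
  ('qX : {poly %/ h}) ^+ b = in_qpoly h 'X^b.
Proof. by elim: b => [|b IHb]; rewrite ?expr0 ?in_qpoly1 // !exprS IHb in_qpolyM. Qed.

Lemma dim_linear_surj (K : fieldType) (V W : vectType K) (h : V -> W) :
  linear h -> (forall w, exists v, h v = w) -> (\dim {:W} <= \dim {:V})%N.
Proof.
move=> h_lin h_surj.
pose H : {linear V -> W} := HB.pack h (GRing.isLinear.Build K V W *:%R h h_lin).
rewrite -(limg_ker_dim (linfun H) fullv) (_ : limg (linfun H) = fullv) ?leq_addl //.
apply/vspaceP => w; rewrite memvf; apply/memv_imgP.
by have [v <-] := h_surj w; exists v; rewrite ?memvf // lfunE.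
Qed.

Lemma dim_ffun_qpoly (K : fieldType) (f : {poly K}) (J : finType) :
  f \is monic -> (1 < size f)%N ->
  \dim {: {ffun J -> {poly %/ f}}} = (#|J| * (size f).-1)%N.
Proof. by move=> f_monic f_gt1; rewrite dimvf /= /mk_monic f_gt1 f_monic. Qed.

Section JordanType.
Context (K : fieldType) (V : vectType K) (f : {poly K}) (s n : 'End(V)).
Context (lam : part).
Hypothesis f_monic : f \is monic.
Hypothesis f_irr : irreducible_poly f.
Hypothesis typ_sn : has_typ f s n lam.
Local Notation L := {poly %/ f}.

(** [vec i y] is the vector whose block i is the class of y and whose other blocks are 0. Taking y
    in L[T] keeps the dependent quotients out of the later computation. *)
Lemma has_typ_generators :
  exists vec : 'I_(size lam) -> {poly L} -> V,
    [/\ forall i, {morph vec i : y z / y + z},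
        forall (i : 'I_(size lam)) g y,
          poly_act s g (vec i y) = vec i (in_qpoly f g *: y),
        forall (i : 'I_(size lam)) y, n (vec i y) = vec i ('X * y),
        forall (i : 'I_(size lam)) y b, (nth 0%N lam i <= b)%N -> vec i ('X^b * y) = 0
      & forall v, exists y, v = \sum_i vec i (y i)].
Proof.
have [psi [[psi' psiK psi'K] psiD psiZ psiX]] := typ_sn.
have psi_ext u v : (forall k, psi u k = psi v k) -> u = v by move/ffunP/(can_inj psiK).
pose vec (i : 'I_(size lam)) (y : {poly L}) := psi' [ffun k : 'I_(size lam) =>
  (if k == i then in_qpoly 'X^(nth 0%N lam k) y else 0)
     : {poly %/ ('X^(nth 0%N lam k) : {poly L})}].
have psi0 k : psi 0 k = 0 by apply: (addIr (psi 0 k)); rewrite -psiD !add0r.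
exists vec; split=> [i y z|i g y|i y|i y b le_lam_b|v].
- apply: psi_ext => k; rewrite psiD !psi'K !ffunE; case: eqP => _; last by rewrite addr0.
  by rewrite in_qpolyD.
- apply: psi_ext => k; rewrite psiZ !psi'K !ffunE; case: eqP => _.
    by rewrite in_qpolyZ.
  by rewrite scaler0.
- apply: psi_ext => k; rewrite psiX !psi'K !ffunE; case: eqP => _; last by rewrite mulr0.
  by rewrite in_qpolyM.
- apply: psi_ext => k; rewrite psi0 psi'K ffunE; case: eqP => [->|//].
  by rewrite in_qpolyXn_eq0 // nth_part_gt0.
exists (fun i => psi v i); apply: psi_ext => k.
rewrite (big_morph (fun v => psi v k) (fun u v => psiD k u v) (psi0 k)).
rewrite (bigD1 k) //= psi'K ffunE eqxx in_qpoly_val big1 ?addr0 // => i /negPf ik.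
by rewrite psi'K ffunE eq_sym ik.
Qed.

(** Reading off the coefficients of all blocks is a K-linear surjection from V onto a power of L
    whose exponent is the sum of the parts. *)
Lemma has_typ_dim : ((size f).-1 * \sum_(i < size lam) nth 0 lam i <= \dim {:V})%N.
Proof.
have [psi [[psi' psiK psi'K] psiD psiZ _]] := typ_sn.
pose J := {i : 'I_(size lam) & 'I_(nth 0%N lam i)}.
pose coefs v : {ffun J -> L} := [ffun p : J => (psi v (tag p) : {poly L})`_(tagged p)].
have coefs_linear : linear coefs.
  move=> a u v; apply/ffunP => p; rewrite !ffunE psiD poly_of_qpolyD coefD.
  by rewrite -(poly_actC s) psiZ poly_of_qpolyZ coefZ in_qpolyC mul_qpolyC.
have coefs_surj c : exists v, coefs v = c.
  pose y (i : 'I_(size lam)) := \sum_(j < nth 0%N lam i)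
    c (Tagged (fun i : 'I_(size lam) => 'I_(nth 0%N lam i)) j) *: 'X^j.
  exists (psi' [ffun i : 'I_(size lam) => in_qpoly 'X^(nth 0%N lam i) (y i)]).
  apply/ffunP => -[i j]; rewrite !ffunE /= psi'K ffunE.
  rewrite in_qpoly_small ?coef_sum_monomials //.
  by rewrite size_mk_monicXn ?nth_part_gt0 // ltnS size_sum_monomials.
have := dim_linear_surj coefs_linear coefs_surj.
rewrite dim_ffun_qpoly ?card_tagged_ord 1?mulnC //.
by have [] := f_irr.
Qed.

Lemma has_typ_has_inv q :
    (0 < q)%N -> (forall i, (i < q)%N -> f %| f^`N(i)) -> ~~ (f %| f^`N(q)) ->
  has_inv f (s + n) (\sum_(t : 'I_(size lam) * 'I_q)
    single (nth 0 lam t.1 %/ q + (t.2 < nth 0 lam t.1 %% q))%N).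
Proof.
move=> q_gt0 dvd_lt ndvd_q.
have [u fE [c uc1]] := translate_self f_monic f_irr dvd_lt ndvd_q.
have [vec [vecD vecs vecn vec0 vec_gen]] := has_typ_generators.
have vecz i : vec i 0 = 0 by rewrite -(mulr0 'X^(nth 0%N lam i)) vec0.
(* On each block s + n is multiplication by theta + T, so g acts as g(theta + T). *)
have vec_translate i g y : poly_act (s + n) g (vec i y) = vec i (translate f g * y).
  elim/poly_ind: g y => [|g a IHg] y.
    by rewrite poly_act0l rmorph0 mul0r vecz.
  rewrite poly_actDl poly_actM poly_actX add_lfunE -[s (vec i y)]poly_actX vecs vecn.
  rewrite -vecD IHg poly_actC -(poly_actC s) vecs -vecD rmorphD rmorphM /=.
  rewrite translateX translateC in_qpolyC -!mul_polyC mulrDl -mulrA [in RHS]mulrDl.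
  by rewrite [_%:P * y + 'X * y]addrC.
pose e (a c : nat) := (a %/ q + (c < a %% q))%N.
apply: (@has_inv_generators _ _ f (s + n) f_monic _ _
  (fun t : 'I_(size lam) * 'I_q => vec t.1 'X^(t.2))
  (fun t : 'I_(size lam) * 'I_q => e (nth 0 lam t.1) t.2)%N).
- by have [] := f_irr.
- case=> i j /=; set a := nth 0%N lam i.
  (* f(x)^e T^j is a multiple of T^(q e + j), and q e + j >= a: for j < a mod q the extra q covers
     the remainder, otherwise j does. *)
  rewrite vec_translate rmorphXn /= fE exprMn mulrAC -exprM -exprD.
  apply: vec0; rewrite -/a {1}(divn_eq a q) /e mulnDr mulnC addnAC -addnA leq_add2l.
  case: (ltnP j) => [_|le_j]; last by rewrite muln0 addn0.
  by rewrite muln1 (leq_trans (ltnW (ltn_pmod a q_gt0))) // leq_addl.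
- move=> U genU; apply/vspaceP => v; rewrite memvf.
  have [y ->] := vec_gen v; apply: memv_suml => i _.
  (* Descending induction on m: [k] bounds the distance from m to the exponent at which the block
     vanishes. *)
  suff vecU k m z : (nth 0%N lam i <= m + k)%N -> vec i ('X^m * z) \in U.
    by rewrite -[y i]mul1r -(expr0 'X) (vecU (nth 0%N lam i)).
  elim: k m z => [|k IHk] m z; first by rewrite addn0 => /vec0->; rewrite mem0v.
  rewrite addnS -addSn => le_lam.
  (* Chosen so that [z'] and [z] have the same constant term: the power of [c] cancels the constant
     term of u^(m/q), and theta + T becomes theta at T = 0. *)
  pose h : {poly K} := z`_0 * c ^+ (m %/ q).
  pose z' := u ^+ (m %/ q) * translate f h.
  have [r rE] : exists r, z - z' = 'X * r.
    have /factor_theorem[r] : root (z - z') 0.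
      rewrite rootE hornerD hornerN hornerM horner_exp !horner_coef0.
      rewrite coef_translate nderivn0 in_qpoly_val mulrCA -exprMn uc1.
      by rewrite expr1n mulr1 subrr.
    by rewrite subr0 mulrC => ->; exists r.
  rewrite -(subrK z' z) mulrDr vecD rE mulrA -exprSr; apply: memvD.
    exact: IHk.
  (* T^m z' is f(x)^(m/q) h(x) applied to the generator T^(m mod q). *)
  have := genU (i, Ordinal (ltn_pmod m q_gt0)) (f ^+ (m %/ q) * h) => /=.
  rewrite vec_translate rmorphM rmorphXn /= fE exprMn -exprM mulrC.
  by rewrite !mulrA -exprD mulnC addnC -divn_eq -mulrA.
apply: leq_trans has_typ_dim; rewrite leq_mul2l; apply/orP; right.
rewrite -(pair_bigA _ (fun (i : 'I_(size lam)) (j : 'I_q) => e (nth 0%N lam i) j)) /=.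
(* For each part a the exponents add up to q (a / q) + a mod q = a. *)
apply: leq_sum => i _; set a := nth 0%N lam i.
rewrite big_split /= sum_nat_const card_ord.
have -> : (\sum_(j < q) (j < a %% q) = a %% q)%N.
  transitivity (\sum_(j < q | j < a %% q) 1)%N.
    by rewrite [RHS]big_mkcond; apply: eq_bigr => j _; case: ltnP.
  by rewrite -(big_ord_widen q (fun=> 1%N)) ?sum1_card ?card_ord // ltnW ?ltn_pmod.
by rewrite mulnC -divn_eq.
Qed.

End JordanType.

(** * Realization of all types *)

Section Realization.
Context (K : fieldType) (f : {poly K}) (lam : part).
Hypothesis f_monic : f \is monic.
Hypothesis f_irr : irreducible_poly f.
Local Notation L := {poly %/ f}.
Local Notation J := {i : 'I_(size lam) & 'I_(nth 0%N lam i)}.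
Local Notation V := {ffun J -> L}.
Local Notation Q i := {poly %/ ('X^(nth 0%N lam i) : {poly L})}.

(** The model space consists of coefficient vectors over L, a K-space of known dimension; here they
    are read as polynomials of degree below each part. *)
Definition to_blocks (v : V) : {dffun forall i : 'I_(size lam), Q i} :=
  [ffun i : 'I_(size lam) => in_qpoly ('X^(nth 0%N lam i) : {poly L})
     (\sum_(j < nth 0%N lam i)
        v (Tagged (fun i : 'I_(size lam) => 'I_(nth 0%N lam i)) j) *: 'X^j)].

Definition of_blocks (y : {dffun forall i : 'I_(size lam), Q i}) : V :=
  [ffun p : J => (y (tag p) : {poly L})`_(tagged p)].

Lemma to_blocksK : cancel to_blocks of_blocks.
Proof.
move=> v; apply/ffunP => -[i j]; rewrite 2!ffunE in_qpoly_small.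
  exact: (coef_sum_monomials _ j).
by rewrite size_mk_monicXn ?nth_part_gt0 // ltnS size_sum_monomials.
Qed.

Lemma of_blocksK : cancel of_blocks to_blocks.
Proof.
move=> y; apply/ffunP => i; rewrite ffunE.
under eq_bigr => j _ do rewrite ffunE /=.
rewrite -poly_sum_monomials ?in_qpoly_val // -ltnS.
by rewrite (leq_trans (size_mk_monic (y i))) // size_mk_monicXn ?nth_part_gt0.
Qed.

Lemma to_blocksD u v i : to_blocks (u + v) i = to_blocks u i + to_blocks v i.
Proof.
rewrite !ffunE -in_qpolyD -big_split; congr in_qpoly; apply: eq_bigr => j _ /=.
by rewrite ffunE scalerDl.
Qed.

Lemma to_blocksZ c (v : V) i : to_blocks [ffun p => c * v p] i = c *: to_blocks v i.
Proof.
rewrite !ffunE -in_qpolyZ scaler_sumr; congr in_qpoly; apply: eq_bigr => j _ /=.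
by rewrite ffunE scalerA.
Qed.

Definition semisimple_fun (v : V) : V := [ffun p => 'qX * v p].

(** The shift within each Jordan block, obtained by transporting multiplication by T. *)
Definition nilpotent_fun (v : V) : V :=
  of_blocks [ffun i : 'I_(size lam) => 'qX * to_blocks v i].

Lemma to_blocks_nilpotent v i :
  to_blocks (nilpotent_fun v) i = 'qX * to_blocks v i.
Proof. by rewrite of_blocksK ffunE. Qed.

Lemma semisimple_fun_linear : linear semisimple_fun.
Proof. by move=> a u v; apply/ffunP => p; rewrite !ffunE mulrDr scalerAr. Qed.

Lemma nilpotent_fun_linear : linear nilpotent_fun.
Proof.
move=> a u v; apply: (can_inj to_blocksK); apply/ffunP => i.
have scaleE (w : V) : a *: w = [ffun p => qpolyC f a * w p] :> V.
  by apply/ffunP => p; rewrite !ffunE mul_qpolyC.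
rewrite to_blocksD !scaleE to_blocksZ !to_blocks_nilpotent.
by rewrite to_blocksD to_blocksZ mulrDr scalerAr.
Qed.

HB.instance Definition _ :=
  GRing.isLinear.Build K V V *:%R semisimple_fun semisimple_fun_linear.
HB.instance Definition _ :=
  GRing.isLinear.Build K V V *:%R nilpotent_fun nilpotent_fun_linear.

Let s : 'End(V) := linfun semisimple_fun.
Let n : 'End(V) := linfun nilpotent_fun.

Lemma poly_act_semisimple g (v : V) : poly_act s g v = [ffun p => in_qpoly f g * v p].
Proof.
elim/poly_ind: g v => [|g c IHg] v; apply/ffunP => p; rewrite ffunE.
  by rewrite poly_act0l in_qpoly0 mul0r ffunE.
rewrite poly_actDl poly_actM poly_actX poly_actC IHg lfunE /= !ffunE.
by rewrite in_qpolyD in_qpolyM in_qpolyC mulrDl mul_qpolyC mulrA.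
Qed.

Lemma realization_has_typ : has_typ f s n lam.
Proof.
exists to_blocks; split.
- by exists of_blocks; [exact: to_blocksK | exact: of_blocksK].
- by move=> i u v; exact: to_blocksD.
- by move=> i g v; rewrite poly_act_semisimple to_blocksZ.
- by move=> i v; rewrite lfunE to_blocks_nilpotent.
Qed.

Lemma realization_jordan_pair : jordan_pair f s n.
Proof.
have f_gt1 : (1 < size f)%N by have [] := f_irr.
have to_blocksX v i : to_blocks (n v) i = 'qX * to_blocks v i.
  by rewrite lfunE to_blocks_nilpotent.
split.
- apply/lfunP => v; rewrite !comp_lfunE; apply: (can_inj to_blocksK).
  apply/ffunP => i; rewrite to_blocksX -!(poly_actX s) !poly_act_semisimple.
  by rewrite !to_blocksZ to_blocksX scalerAr.
(* The largest part bounds all others, so this power of T kills every block. *)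
- exists (nth 0%N lam 0) => v; apply: (can_inj to_blocksK); apply/ffunP => i.
  have iterX e : to_blocks (iter e n v) i = 'qX ^+ e * to_blocks v i.
    by elim: e => [|e IHe]; rewrite ?expr0 ?mul1r //= to_blocksX IHe exprS mulrA.
  rewrite iterX qpolyXn -['X^(nth 0%N lam 0)]mulr1.
  rewrite in_qpolyXn_eq0 ?nth_part_gt0 ?nth_part_leq //.
  by rewrite mul0r; apply: (addIr (to_blocks 0 i)); rewrite -to_blocksD !add0r.
case: (posnP (size lam)) => [lam0|lam_gt0].
  left; rewrite dim_ffun_qpoly // card_tagged_ord big1 // => i.
  by have := ltn_ord i; rewrite {2}lam0.
right; split=> // g; split=> [g0|dvd_fg v].
  (* A nonempty partition provides an entry; there [g] sends the constant function 1 to the class of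
     [g] in L. *)
  have p0 : J by exists (Ordinal lam_gt0); exists 0%N; exact: nth_part_gt0.
  rewrite -in_qpoly_eq0 //; apply/eqP.
  have /ffunP/(_ p0) := g0 [ffun=> 1].
  by rewrite poly_act_semisimple !ffunE mulr1.
apply/ffunP => p; rewrite poly_act_semisimple !ffunE.
by move: dvd_fg; rewrite -in_qpoly_eq0 // => /eqP->; rewrite mul0r.
Qed.

End Realization.

(** Every partition occurs as a type, so the property defining zeta_f pins down its value at every
    partition. *)
Lemma exists_jordan_pair (K : fieldType) (f : {poly K}) (lam : part) :
    f \is monic -> irreducible_poly f ->
  exists (V : vectType K) (s n : 'End(V)),
    [/\ ((size f).-1 %| \dim {:V})%N, jordan_pair f s n & has_typ f s n lam].
Proof.
move=> f_monic f_irr; do 3 eexists; split; last exact: realization_has_typ.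
  by rewrite dim_ffun_qpoly ?dvdn_mull //; have [] := f_irr.
exact: realization_jordan_pair.
Qed.

(** * The explicit map on partitions and the theorem *)

Section InsepZeta.
Context (q : nat).

(** With a = k q + l, the sum over c < q writes l copies of [k+1] and q - l copies of [k] uniformly;
    for k = 0 the latter are neutral. Summing over all parts makes additivity immediate. *)
Definition insep_zeta (lam : part) : part :=
  \sum_(a <- lam) \sum_(c < q) single (a %/ q + (c < a %% q))%N.

Fact insep_zeta_is_nmod_morphism : nmod_morphism insep_zeta.
Proof.
split=> [|lam mu]; first by rewrite /insep_zeta big_nil.
by rewrite /insep_zeta (perm_big _ (part_add_perm lam mu)) big_cat.
Qed.

HB.instance Definition _ :=
  GRing.isNmodMorphism.Build part part insep_zeta insep_zeta_is_nmod_morphism.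

Lemma insep_zeta_single a k l : (0 < a)%N -> a = (k * q + l)%N -> (l < q)%N ->
  insep_zeta (single a) = single k.+1 *+ l + single k *+ (q - l).
Proof.
move=> a_gt0 aE lt_lq; have q_gt0 : (0 < q)%N by apply: leq_ltn_trans lt_lq.
rewrite /insep_zeta /single parts_mkpart /= a_gt0 big_seq1 aE.
rewrite divnMDl // divn_small // modnMDl modn_small // addn0.
rewrite -(big_mkord xpredT (fun c => single (k + (c < l)))) /=.
(* The indicator of c < l is 1 on the first l terms and 0 on the other q - l. *)
rewrite (big_cat_nat (leq0n l) (ltnW lt_lq)) /=; congr (_ + _).
  rewrite -[in RHS](subn0 l) -sumr_const_nat; apply: eq_big_nat => c /= lt_cl.
  by rewrite lt_cl addn1.
rewrite -sumr_const_nat; apply: eq_big_nat => c /andP[le_lc _].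
by rewrite ltnNge le_lc addn0.
Qed.

End InsepZeta.

Theorem theoremB (K : fieldType) (f : {poly K})
    (f_monic : f \is monic) (f_irr : irreducible_poly f)
    (Kbar : closedFieldType) (iota : {rmorphism K -> Kbar})
    (Kbar_alg : forall z : Kbar, algebraicOver iota z)
    (q : nat) (q_insep : is_insep_degree iota f q) :
  exists zeta : {additive part -> part},
    [/\ is_zeta f zeta,
        forall zeta' : part -> part, is_zeta f zeta' -> zeta' =1 zeta
      & forall a k l : nat, (0 < a)%N -> a = (k * q + l)%N -> (l < q)%N ->
          zeta (single a) = single k.+1 *+ l + single k *+ (q - l) /\
          zeta (single a) = mkpart (nseq l k.+1 ++ nseq (q - l) k)].
Proof.
have f_gt1 : (1 < size f)%N by have [] := f_irr.
(* A root in [Kbar] turns the multiplicity hypothesis into divisibility of the divided derivatives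
   by f. *)
have [z fz] : exists z, root (map_poly iota f) z.
  by apply/closed_rootP; rewrite size_map_poly neq_ltn f_gt1 orbT.
have q_gt0 : (0 < q)%N.
  rewrite -(q_insep z fz) -XsubC_dvd -?root_factor_theorem //.
  by rewrite map_poly_eq0 irredp_neq0.
have zetaP : is_zeta f (insep_zeta q).
  move=> V s n lam _ _ typ_sn.
  have -> : insep_zeta q lam = \sum_(t : 'I_(size lam) * 'I_q)
      single (nth 0 lam t.1 %/ q + (t.2 < nth 0 lam t.1 %% q))%N.
    by rewrite /insep_zeta (big_nth 0%N) big_mkord pair_big.
  apply: has_typ_has_inv => // [i lt_iq|].
    by rewrite (dvdp_nderivn_mup f_irr fz) (q_insep z fz) // ltnW.
  by rewrite (dvdp_nderivn_mup f_irr fz) (q_insep z fz) // ltnn.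
exists (insep_zeta q : {additive part -> part}).
split=> // [zeta' zeta'P lam|a k l a_gt0 aE lt_lq].
  (* Uniqueness: once [lam] is realized as a type, both maps give the invariant of the same
     endomorphism. *)
  have [V [s [n [dvd_d pair_sn typ_sn]]]] := exists_jordan_pair lam f_monic f_irr.
  exact: (has_inv_inj f_monic f_gt1 (zeta'P V s n lam dvd_d pair_sn typ_sn)
                      (zetaP V s n lam dvd_d pair_sn typ_sn)).
split; first exact: insep_zeta_single.
rewrite [LHS](insep_zeta_single a_gt0 aE lt_lq) mkpartE big_cat !big_nseq.
by rewrite !iter_addr_0.
Qed.
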